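(* Let $G$ be a finite group and suppose we have a sequence of surjective homomorphisms \[ G = G_0 \xrightarrow{Q_1} G_1 \xrightarrow{Q_2} G_2 \xrightarrow{Q_3} \cdots \xrightarrow{Q_{k-1}} G_{k-1} \xrightarrow{Q_k} G_k = \{e\}. \] For $0 \leq j \leq k$, define $\tilde{Q}_j\colon G \to G_j$ by $\tilde{Q}_j = Q_j\circ Q_{j-1}\circ\dots\circ Q_1$ (so $\tilde{Q}_0 = \operatorname{id}_G$), and for $1 \leq j \leq k$ define the normal subgroup $H_j \trianglelefteq G_{j-1}$ by $H_j = \ker Q_j$. Let $\mu_1, \dots, \mu_n$ be probability measures on $G$ and let $\nu_n = \mu_1*\dots* \mu_n$. For each $j = 1, \dots, k$, let $I_j = \{i \in\{1,\dots,n\}\mid \langle \operatorname{supp} (\tilde{Q}_{j-1})_* \mu_i \rangle = H_j \}$. Let $\pi$ be the uniform distribution on $G$. For $1\le j\le k$ and $i \in I_j$, let $\sigma_{i,j}$ be the second-largest singular value of the $(\tilde{Q}_{j-1})_* \mu_i$-random walk on $H_j$, i.e. of the convolution operator $*\big((\tilde{Q}_{j-1})_* \mu_i\big)$ on $L^2(H_j)$. If each $I_j$ is nonempty, then \[ \|\nu_n - \pi\|_{L^2}^2 \leq \sum_{j=1}^k \frac{|G_{j-1}| - 1}{|G|}\left(\prod_{i \in I_j} \sigma_{i,j}^2\right) = \sum_{j=1}^k \frac{\left(\prod_{i=j}^{k} |H_i|\right) - 1}{|G|}\left(\prod_{i \in I_j} \sigma_{i,j}^2\right). \]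
   Context: For a finite set $S$, $L^2(S)$ is the space of real-valued functions (signed measures) on $S$ with norm $\|f\|_{L^2}^2 = \sum_{s\in S}|f(s)|^2$. For a finite group $G$ and $\mu,\nu\in L^2(G)$, the convolution is $(\mu*\nu)(g) = \sum_{h\in G}\mu(h)\nu(h^{-1}g)$, and $*\mu$ denotes the linear operator $\nu\mapsto \nu*\mu$ on $L^2(G)$. A measure supported in a subgroup $K$ is also viewed as an element of $L^2(K)$, with convolution operator on $L^2(K)$. For a map $f\colon S\to T$, the pushforward $f_*\colon L^2(S)\to L^2(T)$ is $f_*\mu(t)=\mu(f^{-1}(t))$. The uniform distribution is $\pi(g)=1/|G|$. $\langle T\rangle$ denotes the subgroup generated by $T$. The second-largest singular value is taken counting multiplicity (e.g. singular values $1,1,0$ have second-largest singular value $1$); on a one-dimensional space (trivial group) it is taken to be $0$. *)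

(* Defs.v *)
(* Mathematical Components, with the real numbers of MathComp-Analysis. *)
From HB Require Import structures.
From mathcomp Require Import all_boot all_order all_fingroup all_algebra.
From mathcomp Require Import polyrcf.
From mathcomp Require Import reals.

Set Implicit Arguments.
Unset Strict Implicit.
Unset Printing Implicit Defensive.

Import Order.TTheory GRing.Theory Num.Theory.
Local Open Scope ring_scope.

(* L^2(S) is [{ffun S -> R}]. *)
Section FiniteSets.
Variable R : realType.
Implicit Types S T : finType.

Definition l2norm S (f : {ffun S -> R}) : R :=
  Num.sqrt (\sum_(s : S) `|f s| ^+ 2).

Definition is_prob S (mu : {ffun S -> R}) : Prop :=
  (forall s, 0 <= mu s) /\ \sum_(s : S) mu s = 1.

Definition supp S (mu : {ffun S -> R}) : {set S} := [set s | mu s != 0].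

Definition pushforward S T (f : S -> T) (mu : {ffun S -> R}) : {ffun T -> R} :=
  [ffun t => \sum_(s : S | f s == t) mu s].

Definition dirac S (s : S) : {ffun S -> R} := [ffun t => (t == s)%:R].

Definition uniform S : {ffun S -> R} := [ffun => #|S|%:R^-1].

(* The [dirac s] form an orthonormal basis of L^2(S), so the adjoint of a
   linear operator [A] has the transposed matrix. *)
Definition op_mx S (A : {ffun S -> R} -> {ffun S -> R}) : 'M[R]_#|S| :=
  \matrix_(i, j) A (dirac (enum_val j)) (enum_val i).

(* The square roots of the eigenvalues of A^T A, repeated according to their
   multiplicity and listed in decreasing order: [rootsR p] lists every root of
   [p] once, and [mup x p] is the multiplicity of the root [x]. *)
Definition singular_values m (A : 'M[R]_m) : seq R :=
  let p := char_poly (A^T *m A) in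
  sort >=%R (flatten [seq nseq (mup x p) (Num.sqrt x) | x <- rootsR p]).

(* This is 0 on a space of dimension at most 1. *)
Definition second_singular_value S (A : {ffun S -> R} -> {ffun S -> R}) : R :=
  (singular_values (op_mx A))`_1.

End FiniteSets.

Arguments dirac {R S} s.
Arguments uniform {R} S.

Section Convolution.
Variable R : realType.
Implicit Types G : finGroupType.

Definition conv G (mu nu : {ffun G -> R}) : {ffun G -> R} :=
  [ffun g => \sum_(h : G) mu h * nu (h^-1 * g)%g].

Definition conv_op G (mu nu : {ffun G -> R}) : {ffun G -> R} := conv nu mu.

(* mu_0 * (mu_1 * ... * (mu_(n-1) * dirac 1)) *)
Definition conv_prod G n (mu : 'I_n -> {ffun G -> R}) : {ffun G -> R} :=
  \big[@conv G/dirac 1%g]_(i < n) mu i.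

(* A measure on G supported in H, as an element of L^2(H). *)
Definition restrict G (H : {group G}) (mu : {ffun G -> R}) :
    {ffun subg_of H -> R} :=
  [ffun x => mu (sgval x)].

End Convolution.

(* [Q j] goes from [G j] to [G j.+1]: the j-th map and the j-th kernel are
   numbered from 0 instead of 1. *)
Section Tower.
Variables (R : realType) (G : nat -> finGroupType).
Variable Q : forall j, {morphism [set: G j] >-> G j.+1}.

Fixpoint Qtilde (j : nat) : G 0%N -> G j :=
  match j with
  | 0 => id
  | j'.+1 => fun g => Q j' (Qtilde j' g)
  end.

Definition Hker (j : nat) : {group G j} := ('ker (Q j))%G.

Section Walk.
Variables (n : nat) (mu : 'I_n -> {ffun G 0%N -> R}).

Definition walk_measure (j : nat) (i : 'I_n) : {ffun G j -> R} :=
  pushforward (Qtilde j) (mu i).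

Definition Iset (j : nat) : {set 'I_n} :=
  [set i | <<supp (walk_measure j i)>>%g == Hker j :> {set G j}].

Definition sigma (j : nat) (i : 'I_n) : R :=
  second_singular_value (conv_op (restrict (Hker j) (walk_measure j i))).

End Walk.
End Tower.

(* Main.v *)
(* Averaging over the fibres of Qtilde j, for j = 0, ..., k, gives a chain of
   orthogonal projections of L^2(G 0) from the identity to the mean, so the
   squared distance of nu_n to uniform splits into k pieces.  Up to the factor
   |G j| / |G 0|, the j-th piece is the squared norm of the component of the
   pushforward of nu_n to G j that has zero sum on every coset of H_j.  As H_j
   is normal, convolution preserves that component: it contracts it in general,
   and when the step is supported in H_j it acts on each coset as a doubly
   stochastic operator on zero-sum functions, hence shrinks it by the second
   singular value.  The component of the initial Dirac mass has squared norm
   1 - 1/|H_j| <= 1 - 1/|G j|. *)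
From HB Require Import structures.
From mathcomp Require Import all_boot all_order all_fingroup all_algebra.
From mathcomp Require Import polyrcf complex zify ring lra.
From mathcomp Require Import reals.
Require Import Defs.

Set Implicit Arguments.
Unset Strict Implicit.
Unset Printing Implicit Defensive.

Import Order.TTheory GRing.Theory Num.Theory.
Local Open Scope ring_scope.

(** * Singular values read off a list of eigenvalues *)

Lemma char_poly_similar (F : fieldType) m (P A : 'M[F]_m) :
  P \in unitmx -> char_poly (invmx P *m A *m P) = char_poly A.
Proof.
move=> Pu; rewrite /char_poly.
have -> : char_poly_mx (invmx P *m A *m P)
    = map_mx polyC (invmx P) *m char_poly_mx A *m map_mx polyC P.
  rewrite /char_poly_mx !map_mxM mulmxBr mulmxBl scalar_mxC; congr (_ - _).
  by rewrite -mulmxA -map_mxM mulVmx // map_mx1 mulmx1.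
rewrite !det_mulmx mulrC mulrA -det_mulmx -map_mxM mulmxV //.
by rewrite map_mx1 det1 mul1r.
Qed.

(** If the second entry of the decreasing list were below [a], all later ones would be too, leaving
    at most one entry that reaches [a]. *)
Lemma nth1_sort_ge (R : realType) (s : seq R) (a : R) :
  (1 < count (>= a) s)%N -> a <= (sort >=%R s)`_1.
Proof.
have -> : count (>= a) s = count (>= a) (sort >=%R s).
  by apply/seq.permP; rewrite perm_sym perm_sort.
have := sort_sorted (@ge_total _ R) s.
case: (sort _ _) => [|x [|y t]] //=; first by rewrite addn0; case: (a <= x).
case/andP=> _ yt; case: (leP a y) => // ya; rewrite add0n.
suff -> : count (>= a) t = 0%N by rewrite addn0; case: (a <= x).
apply/eqP; rewrite -leqn0 leqNgt -has_count; apply/hasPn => z zt.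
rewrite -ltNge; apply: le_lt_trans ya.
have := order_path_min (@ge_trans _ R) yt.
by move/allP/(_ z zt).
Qed.

(** The multiplicity of a root of a split polynomial is its number of occurrences in [s]. This
    matches the encoding in [singular_values] with the eigenvalues given by any diagonalisation. *)
Lemma rootsR_prod_XsubC (R : rcfType) (s : seq R)
    (p := \prod_(x <- s) ('X - x%:P)) :
  perm_eq (flatten [seq nseq (mup x p) x | x <- rootsR p]) s.
Proof.
have p0 : p != 0 by rewrite monic_neq0 // monic_prod_XsubC.
apply/allP => x _ /=; apply/eqP.
have inr : (x \in rootsR p) = (x \in s).
  by rewrite -(roots_on_rootsR p0) /= root_prod_XsubC.
rewrite count_flatten -map_comp.
rewrite (eq_map (g := fun y => ((y == x) * mup y p)%N)); last first.
  by move=> y /=; rewrite count_nseq.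
rewrite sumnE big_map.
have [xs|xs] := boolP (x \in s).
  rewrite (bigD1_seq x) ?inr ?uniq_roots //= eqxx mul1n big1 ?addn0.
    exact: mu_prod_XsubC.
  by move=> y /negbTE->.
rewrite big1_seq ?(count_memPn xs) // => y /= yr.
by case: eqP yr => [->|//]; rewrite inr (negbTE xs).
Qed.

Lemma perm_singular_values (R : realType) m (A : 'M[R]_m) (s : seq R) :
  char_poly (A^T *m A) = \prod_(x <- s) ('X - x%:P) ->
  perm_eq (singular_values A) [seq Num.sqrt x | x <- s].
Proof.
move=> ps; rewrite /singular_values perm_sort.
have -> : forall p : {poly R}, flatten [seq nseq (mup x p) (Num.sqrt x) | x <- rootsR p]
  = map Num.sqrt (flatten [seq nseq (mup x p) x | x <- rootsR p]).
  move=> p; rewrite map_flatten -map_comp; congr flatten; apply: eq_map => x /=.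
  by rewrite map_nseq.
by apply: perm_map; rewrite ps; apply: rootsR_prod_XsubC.
Qed.

(** The indices [i] and [j] are distinct while the values [d i] and [d j] may coincide, so a
    repeated eigenvalue counts twice. *)
Lemma le_second_singular_value (R : realType) m (A : 'M[R]_m) (d : 'I_m -> R) i j a :
    char_poly (A^T *m A) = \prod_i ('X - (d i)%:P) ->
    i != j -> a <= Num.sqrt (d i) -> a <= Num.sqrt (d j) ->
  a <= (singular_values A)`_1.
Proof.
move=> pd ij ai aj.
have pd' : char_poly (A^T *m A) = \prod_(x <- map d (enum 'I_m)) ('X - x%:P).
  by rewrite pd big_map big_enum.
have pm := perm_singular_values pd'.
apply: nth1_sort_ge.
move: pm; rewrite /singular_values perm_sort => /seq.permP->.
rewrite -map_comp count_map -size_filter.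
have /uniq_leq_size : uniq [:: i; j] by rewrite /= inE ij.
apply => x; rewrite mem_filter mem_enum !inE /= => /orP[] /eqP->.
  by rewrite ai.
by rewrite aj.
Qed.

(** * Spectral theorem and the role of the second singular value *)

Section Spectral.
Local Open Scope sesquilinear_scope.

(** Over [R[i]] a real symmetric matrix is Hermitian, hence unitarily diagonalisable with real
    spectrum. A complex eigenbasis is enough, since norms and inner products of real vectors can be
    computed in it. *)
Lemma sym_spectral (R : realType) m (M : 'M[R]_m) : M^T = M ->
  exists (d : 'rV[R]_m) (P : 'M[R[i]]_m),
    [/\ P \is unitarymx,
        map_mx (real_complex R) M = P^t* *m diag_mx (map_mx (real_complex R) d) *m P
      & char_poly M = \prod_i ('X - (d 0 i)%:P)].
Proof.
move=> Msym; set MC := map_mx _ M.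
have Mherm : MC \is hermsymmx.
  apply: realsym_hermsym.
    apply/is_hermitianmxP; rewrite expr0 scale1r map_mx_id //.
    by rewrite map_trmx Msym.
  by apply/mxOverP => i j; rewrite mxE; apply/complex_realP; exists (M i j).
have /orthomx_spectralP MCE := hermitian_normalmx Mherm.
have dr := hermitian_spectral_diag_real Mherm.
pose d := map_mx (@complex.Re R) (spectral_diag MC).
have dE : map_mx (real_complex R) d = spectral_diag MC.
  apply/matrixP => i j; rewrite !mxE RRe_real //.
  exact: (mxOverP dr).
exists d, (spectralmx MC); rewrite dE spectral_unitarymx; split=> //.
  by rewrite -invmx_unitary ?spectral_unitarymx.
(* The embedding of [R] into [R[i]] is injective on polynomials, so the factorisation descends to
   [R]. *)
apply: (map_poly_inj (real_complex R)).
rewrite map_char_poly -/MC MCE char_poly_similar ?spectral_unit //.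
rewrite char_poly_trig ?diag_mx_is_trig // rmorph_prod /=; apply: eq_bigr => i _.
by rewrite -dE !mxE eqxx mulr1n map_polyXsubC.
Qed.

Lemma map_mx_real_conj (R : rcfType) m n (M : 'M[R]_(m, n)) :
  (map_mx (real_complex R) M)^t* = map_mx (real_complex R) M^T.
Proof.
apply/matrixP => i j; rewrite !mxE; apply/CrealP/complex_realP.
by exists (M j i).
Qed.

(* In the orthonormal eigenbasis of [A^T *m A], the constant vector only has
   coordinates of eigenvalue 1, so either two eigenvalues are at least 1 and
   contractivity is enough, or the eigenvalue 1 is simple and [v] has no
   coordinate along it. *)
Lemma second_singular_value_bound (R : realType) m (A : 'M[R]_m) :
    (forall v : 'cV_m, \sum_i (A *m v) i 0 ^+ 2 <= \sum_i v i 0 ^+ 2) ->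
    A^T *m A *m const_mx 1 = const_mx 1 :> 'cV_m ->
  forall v : 'cV_m, \sum_i v i 0 = 0 ->
  \sum_i (A *m v) i 0 ^+ 2 <= (singular_values A)`_1 ^+ 2 * \sum_i v i 0 ^+ 2.
Proof.
move=> Acontr A1 v v0; set s := (singular_values A)`_1.
have [s1|s1] := leP 1 s.
  apply: le_trans (Acontr v) _; rewrite ler_peMl ?exprn_ege1 //.
  by apply: sumr_ge0 => i _; apply: sqr_ge0.
case: (posnP m) => [m0|m_gt0].
  by subst m; rewrite !big_ord0 mulr0.
have Msym : (A^T *m A)^T = A^T *m A by rewrite trmx_mul trmxK.
have [d [P [Pu MP charM]]] := sym_spectral Msym.
pose toC := real_complex R.
have PP : P^t* *m P = 1%:M.
  by rewrite -invmx_unitary // mulVmx // unitarymx_unit.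
(* Coordinates in the eigenbasis: [u] for [v], [z] for the constant vector. *)
pose u := P *m map_mx toC v; pose z := P *m map_mx toC (const_mx 1 : 'cV_m).
have sumC (w : 'cV[R]_m) :
    (\sum_i w i 0 ^+ 2)%:C%C = ((map_mx toC w)^t* *m map_mx toC w) 0 0.
  rewrite rmorph_sum mxE; apply: eq_bigr => i _.
  by rewrite map_mx_real_conj !mxE -rmorphM.
have uE : (\sum_i v i 0 ^+ 2)%:C%C = \sum_i `|u i 0| ^+ 2.
  rewrite sumC.
  have -> : (map_mx toC v)^t* *m map_mx toC v = u^t* *m u.
    by rewrite /u trmx_mul map_mxM mulmxA -(mulmxA _ (P^t*)) PP mulmx1.
  by rewrite mxE; apply: eq_bigr => i _; rewrite !mxE normCK mulrC.
have AuE : (\sum_i (A *m v) i 0 ^+ 2)%:C%C = \sum_i (d 0 i)%:C%C * `|u i 0| ^+ 2.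
  rewrite sumC.
  have -> : (map_mx toC (A *m v))^t* *m map_mx toC (A *m v)
      = u^t* *m diag_mx (map_mx toC d) *m u.
    rewrite map_mx_real_conj trmx_mul -map_mxM mulmxA -(mulmxA v^T) map_mxM.
    rewrite [map_mx toC (_ *m (_ *m _))]map_mxM MP /u trmx_mul map_mxM.
    rewrite -map_mx_real_conj.
    by rewrite !mulmxA.
  rewrite mxE; apply: eq_bigr => i _.
  rewrite mul_mx_diag !mxE normCK. set a := \sum_j _.
  by rewrite mulrAC [_ * a]mulrC; apply: mulrC.
have Dz i : (d 0 i)%:C%C * z i 0 = z i 0.
  have : diag_mx (map_mx toC d) *m z = z.
    rewrite /z -[in RHS]A1 [in RHS]map_mxM MP !mulmxA.
    by rewrite (unitarymxP Pu) mul1mx.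
  by move/matrixP/(_ i 0); rewrite mul_diag_mx !mxE.
have uz : \sum_i (z i 0)^* * u i 0 = 0.
  transitivity ((z^t* *m u) 0 0).
    by rewrite [RHS]mxE; apply: eq_bigr => i _; rewrite !mxE.
  rewrite /z /u trmx_mul map_mxM mulmxA -(mulmxA _ (P^t*)) PP mulmx1.
  rewrite map_mx_real_conj -map_mxM !mxE -[RHS](rmorph0 toC) -[in RHS]v0; congr toC.
  by apply: eq_bigr => i _; rewrite !mxE mul1r.
have [i0 zi0] : exists i0, z i0 0 != 0.
  apply/existsP; apply: contraT; rewrite negb_exists => /forallP z0.
  have : P^t* *m z = 0.
    rewrite (_ : z = 0) ?mulmx0 //; apply/matrixP => i j; rewrite ord1 [RHS]mxE.
    by apply/eqP; have := z0 i; rewrite negbK.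
  rewrite /z mulmxA PP mul1mx => /matrixP/(_ (Ordinal m_gt0) 0).
  by rewrite !mxE => /eqP; rewrite oner_eq0.
have di0 : d 0 i0 = 1.
  apply: (@complexI R); apply: (mulIf zi0); rewrite Dz.
  by rewrite rmorph1 mul1r.
have sd i : i != i0 -> Num.sqrt (d 0 i) <= s.
  move=> ii0; have sv := le_second_singular_value charM ii0.
  (* The minimum is below the singular values at both [i] and [i0], the latter being 1. Hence it is
     at most [s], and [s < 1] forces it to be the one at [i]. *)
  have := sv (Num.min 1 (Num.sqrt (d 0 i))).
  rewrite di0 sqrtr1 !ge_min !lexx orbT /= => /(_ isT isT).
  by rewrite leNgt s1.
have ds i : i != i0 -> d 0 i <= s ^+ 2.
  move=> ii0; have sq0 := sqrtr_ge0 (d 0 i).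
  apply: le_trans (_ : Num.sqrt (d 0 i) ^+ 2 <= _); last first.
    by rewrite lerXn2r ?nnegrE ?sd ?(le_trans sq0) ?sd.
  (* The sign of the eigenvalue is not recorded by [sym_spectral], and [Num.sqrt] is 0 on negative
     numbers, so that case is treated apart. *)
  have [d0|d0] := leP 0 (d 0 i); first by rewrite sqr_sqrtr.
  by apply: le_trans (ltW d0) _; apply: sqr_ge0.
have z0 i : i != i0 -> z i 0 = 0.
  move=> ii0; apply/eqP; apply: contraT => zi.
  have di : d 0 i = 1.
    by apply: (@complexI R); apply: (mulIf zi); rewrite Dz rmorph1 mul1r.
  by have := sd i ii0; rewrite di sqrtr1 leNgt s1.
have ui0 : u i0 0 = 0.
  apply/eqP; move: uz; rewrite (bigD1 i0) //= big1 ?addr0.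
    by move/eqP; rewrite mulf_eq0 conjC_eq0 (negbTE zi0).
  by move=> i ii0; rewrite z0 // conjC0 mul0r.
rewrite -lecR AuE rmorphM /= uE mulr_sumr; apply: ler_sum => i _.
have [->|ii0] := eqVneq i i0; first by rewrite ui0 normr0 expr0n !mulr0.
by apply: ler_wpM2r; rewrite ?sqr_ge0 ?exprn_ge0 // lecR ds.
Qed.

End Spectral.

(** * Squared norms and doubly stochastic kernels *)

Lemma l2norm_sqr (R : realType) (S : finType) (f : {ffun S -> R}) :
  l2norm f ^+ 2 = \sum_s f s ^+ 2.
Proof.
rewrite /l2norm sqr_sqrtr; first by apply: eq_bigr => s _; rewrite real_normK ?num_real.
by apply: sumr_ge0 => s _; apply: exprn_ge0.
Qed.

(** This is nonnegativity of the variance of [f] under the weights [w]. *)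
Lemma sqr_weighted_sum_le (R : realType) (S : finType) (w f : S -> R) :
  (forall s, 0 <= w s) -> \sum_s w s = 1 ->
  (\sum_s f s * w s) ^+ 2 <= \sum_s f s ^+ 2 * w s.
Proof.
move=> w0 w1; set a := \sum_s f s * w s.
have : 0 <= \sum_s (f s - a) ^+ 2 * w s.
  by apply: sumr_ge0 => s _; apply: mulr_ge0; rewrite ?sqr_ge0.
have -> : \sum_s (f s - a) ^+ 2 * w s
    = \sum_s f s ^+ 2 * w s - a *+ 2 * (\sum_s f s * w s) + a ^+ 2 * \sum_s w s.
  rewrite !mulr_sumr -sumrB -big_split /=.
  by apply: eq_bigr => s _; rewrite sqrrB; ring.
by rewrite w1 -/a => h; rewrite -subr_ge0; apply: le_trans h _; lra.
Qed.

Section Kernel.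
Variables (R : realType) (S : finType) (K : S -> S -> R).
Hypothesis K_ge0 : forall x y, 0 <= K x y.
Hypothesis K_col : forall y, \sum_x K x y = 1.
Hypothesis K_row : forall x, \sum_y K x y = 1.

(** For fixed [y] the weights [K x y] sum to 1, so the previous inequality applies. After exchanging
    the sums, the row sums remove the kernel. *)
Lemma kernel_contraction (f : S -> R) :
  \sum_y (\sum_x f x * K x y) ^+ 2 <= \sum_x f x ^+ 2.
Proof.
apply: le_trans (_ : \sum_y \sum_x f x ^+ 2 * K x y <= _).
  by apply: ler_sum => y _; apply: sqr_weighted_sum_le.
rewrite exchange_big /=; apply: ler_sum => x _.
by rewrite -mulr_sumr K_row mulr1.
Qed.

(** In the basis of Dirac masses [A] has the transpose of [K] as its matrix. The sums [K_col] make
    this matrix fix the constant vector, [K_row] does the same for its transpose, and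
    [kernel_contraction] gives contractivity. *)
Lemma second_singular_value_kernel (A : {ffun S -> R} -> {ffun S -> R}) :
    (forall f y, A f y = \sum_x f x * K x y) ->
  forall f : {ffun S -> R}, \sum_x f x = 0 ->
  \sum_y A f y ^+ 2 <= second_singular_value A ^+ 2 * \sum_x f x ^+ 2.
Proof.
move=> AK f f0.
have sumE (F : S -> R) : \sum_(i < #|S|) F (enum_val i) = \sum_x F x.
  by rewrite [RHS](reindex _ (onW_bij _ (@enum_val_bij S))).
have mxK i j : op_mx A i j = K (enum_val j) (enum_val i).
  rewrite mxE AK (bigD1 (enum_val j)) //= ffunE eqxx mul1r big1 ?addr0 // => x xj.
  by rewrite ffunE (negbTE xj) mul0r.
have mulK (v : 'cV_#|S|) i :
    (op_mx A *m v) i 0 = \sum_x v (enum_rank x) 0 * K x (enum_val i).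
  rewrite mxE -sumE; apply: eq_bigr => j _.
  by rewrite mxK enum_valK mulrC.
pose v : 'cV_#|S| := \col_(i < #|S|) f (enum_val i).
have := @second_singular_value_bound R _ (op_mx A) _ _ v.
rewrite /second_singular_value => bound.
have -> : \sum_y A f y ^+ 2
    = \sum_i (op_mx A *m v) i 0 ^+ 2.
  rewrite -sumE; apply: eq_bigr => i _; rewrite mulK AK; congr (_ ^+ 2).
  by apply: eq_bigr => x _; rewrite mxE enum_rankK.
have -> : \sum_x f x ^+ 2 = \sum_i v i 0 ^+ 2.
  by rewrite -sumE; apply: eq_bigr => i _; rewrite mxE.
apply: bound.
- move=> w; rewrite (eq_bigr _ (fun i _ => congr1 (fun x => x ^+ 2) (mulK w i))).
  rewrite (sumE (fun y => (\sum_x w (enum_rank x) 0 * K x y) ^+ 2)).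
  apply: le_trans (kernel_contraction _) _.
  by rewrite -sumE; under eq_bigr do rewrite enum_valK.
- have A1 : op_mx A *m const_mx 1 = const_mx 1 :> 'cV_#|S|.
    apply/matrixP => i j; rewrite ord1 mulK mxE.
    by under eq_bigr do rewrite mxE mul1r; apply: K_col.
  rewrite -mulmxA A1; apply/matrixP => i j; rewrite !mxE.
  under eq_bigr do rewrite mxE mxK mxE mulr1.
  by rewrite (sumE (fun y => K (enum_val i) y)) K_row.
- by under eq_bigr do rewrite mxE; rewrite sumE.
Qed.

End Kernel.

(** * Convolution on a finite group *)

Lemma sum_mulVg (V : nmodType) (G : finGroupType) (F : G -> V) y :
  \sum_x F (x^-1 * y)%g = \sum_x F x.
Proof. by rewrite [RHS](reindex_inj (inj_comp (mulIg y) invg_inj)). Qed.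

Lemma sum_mulg (V : nmodType) (G : finGroupType) (F : G -> V) x :
  \sum_y F (x * y)%g = \sum_y F y.
Proof. by rewrite [RHS](reindex_inj (mulgI x)). Qed.

Section Convolution.
Variables (R : realType) (G : finGroupType).
Implicit Types (f mu nu : {ffun G -> R}) (H : {group G}).

Lemma convE f mu g : conv f mu g = \sum_h f (g * h^-1)%g * mu h.
Proof.
rewrite ffunE (reindex_inj (inj_comp (mulgI g) invg_inj)) /=.
by apply: eq_bigr => h _; rewrite invMg invgK -mulgA mulVg mulg1.
Qed.

Lemma convA f mu nu : conv f (conv mu nu) = conv (conv f mu) nu.
Proof.
apply/ffunP => g; rewrite ffunE convE.
under eq_bigr do rewrite convE mulr_sumr.
rewrite exchange_big /=; apply: eq_bigr => h _.
rewrite ffunE mulr_suml; apply: eq_bigr => x _.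
by rewrite -mulrA mulgA.
Qed.

Lemma conv_dirac1r f : conv f (dirac 1%g) = f.
Proof.
apply/ffunP => g; rewrite convE (bigD1 1%g) //= ffunE eqxx mulr1 invg1 mulg1.
by rewrite big1 ?addr0 // => h h1; rewrite ffunE (negbTE h1) mulr0.
Qed.

Lemma conv_dirac1l f : conv (dirac 1%g) f = f.
Proof.
apply/ffunP => g; rewrite ffunE (bigD1 1%g) //= ffunE eqxx mul1r invg1 mul1g.
by rewrite big1 ?addr0 // => h h1; rewrite ffunE (negbTE h1) mul0r.
Qed.

Lemma l2norm_conv_le f mu : is_prob mu -> l2norm (conv f mu) ^+ 2 <= l2norm f ^+ 2.
Proof.
move=> [mu0 mu1]; rewrite !l2norm_sqr; under eq_bigr do rewrite ffunE.
apply: (@kernel_contraction _ _ (fun x y => mu (x^-1 * y)%g)) => // x.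
  by rewrite sum_mulVg.
by rewrite sum_mulg.
Qed.

Lemma sum_subg H (F : G -> R) :
  \sum_(x : subg_of H) F (sgval x) = \sum_(x in H) F x.
Proof.
rewrite [RHS](reindex_onto (@sgval _ H) (subg H)) => [|x xH]; last by rewrite subgK.
by apply: eq_bigl => x; rewrite sgvalK eqxx subgP.
Qed.

Lemma sum_lcoset H (F : G -> R) :
  \sum_g \sum_(x in H) F (g * x)%g = #|H|%:R * \sum_g F g.
Proof.
rewrite exchange_big /= (eq_bigr (fun=> \sum_g F g)); last first.
  by move=> x _; rewrite [RHS](reindex_inj (mulIg x)).
by rewrite sumr_const mulr_natl.
Qed.

(* The operator acts separately on each left coset of H; summing over all g the
   bound on the coset gH counts every point |H| times on both sides. *)
Lemma l2norm_conv_subgroup H f mu :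
    is_prob mu -> supp mu \subset H ->
    (forall g, \sum_(x in H) f (g * x)%g = 0) ->
  l2norm (conv f mu) ^+ 2
    <= second_singular_value (conv_op (restrict H mu)) ^+ 2 * l2norm f ^+ 2.
Proof.
move=> [mu0 mu1] muH f0.
have mu_out x : x \notin H -> mu x = 0.
  move=> xH; apply/eqP; apply: contraNT xH => mux.
  by apply: (subsetP muH); rewrite inE.
have H0 : 0 < #|H|%:R :> R by rewrite ltr0n cardG_gt0.
rewrite !l2norm_sqr -(ler_pM2l H0) mulrCA.
rewrite -(sum_lcoset H (fun g => conv f mu g ^+ 2)) -(sum_lcoset H (fun g => f g ^+ 2)).
rewrite mulr_sumr; apply: ler_sum => g _.
(* The restriction of [f] to the coset gH, transported to H by left translation; its sum is zero by
   [f0]. *)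
pose F : {ffun subg_of H -> R} := [ffun x => f (g * sgval x)%g].
have mass : \sum_(x : subg_of H) restrict H mu x = 1.
  under eq_bigr do rewrite ffunE.
  rewrite sum_subg -mu1 [RHS](bigID (mem H)) /= [X in _ = _ + X]big1 ?addr0 //.
have := @second_singular_value_kernel R (subg_of H)
  (fun x y => restrict H mu (x^-1 * y)%g) _ _ _ (conv_op (restrict H mu)) _ F _.
have -> : \sum_x F x ^+ 2 = \sum_(x in H) f (g * x)%g ^+ 2.
  by rewrite -sum_subg; apply: eq_bigr => x _; rewrite ffunE.
have -> : \sum_y conv_op (restrict H mu) F y ^+ 2
    = \sum_(x in H) conv f mu (g * x)%g ^+ 2.
  rewrite -sum_subg; apply: eq_bigr => y _; rewrite !ffunE; congr (_ ^+ 2).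
  under eq_bigr do rewrite !ffunE.
  rewrite (sum_subg H (fun x => f (g * x)%g * mu (x^-1 * sgval y)%g)).
  (* After substituting [g * x], the measure is evaluated at [x^-1 * y] with [y] in H, which lies
     outside H when [x] does. Only the terms of the convolution on H survive. *)
  rewrite [RHS](reindex_inj (mulgI g)) [RHS](bigID (mem H)) /=.
  rewrite [X in _ = _ + X]big1 ?addr0 => [|x xH].
    by apply: eq_bigr => x _; rewrite invMg !mulgA mulgKV.
  rewrite mu_out ?mulr0 // invMg !mulgA mulgKV groupMr ?subgP //.
  by rewrite groupV.
apply.
- by move=> x y; rewrite ffunE.
- by move=> y; rewrite (sum_mulVg (restrict H mu)).
- by move=> x; rewrite (sum_mulg (restrict H mu)).
- by move=> ? ?; rewrite ffunE.
- by under eq_bigr do rewrite ffunE; rewrite (sum_subg H (fun x => f (g * x)%g)).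
Qed.

End Convolution.

(** * Oscillation along the cosets of a normal subgroup *)

(* The component of f orthogonal to the functions constant on left cosets of H. *)
Definition oscillation (R : realType) (G : finGroupType) (H : {group G})
    (f : {ffun G -> R}) : {ffun G -> R} :=
  [ffun g => f g - #|H|%:R^-1 * \sum_(x in H) f (g * x)%g].

Section Oscillation.
Variables (R : realType) (G : finGroupType) (H : {group G}).
Implicit Types f mu : {ffun G -> R}.

Let H_neq0 : #|H|%:R != 0 :> R.
Proof. by rewrite pnatr_eq0 -lt0n cardG_gt0. Qed.

Lemma sum_coset_oscillation f g : \sum_(x in H) oscillation H f (g * x)%g = 0.
Proof.
under eq_bigr do rewrite ffunE.
rewrite sumrB -mulr_sumr.
rewrite [X in _ * X](eq_bigr (fun=> \sum_(x in H) f (g * x)%g)); last first.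
  move=> y yH /=; rewrite [RHS](reindex_inj (mulgI y)) /=.
  apply: eq_big => x; first by rewrite groupMl.
  by rewrite mulgA.
by rewrite sumr_const -[X in _ * X]mulr_natl mulKf // subrr.
Qed.

(** Conjugation by [h] permutes the normal subgroup H, so averaging over right translations by H
    commutes with right translation by [h^-1]. *)
Lemma oscillation_conv f mu : (H <| [set: G])%g ->
  oscillation H (conv f mu) = conv (oscillation H f) mu.
Proof.
move=> nH; apply/ffunP => g; rewrite ffunE !convE.
have -> : \sum_(x in H) conv f mu (g * x)%g
    = \sum_h (\sum_(x in H) f (g * h^-1 * x)%g) * mu h.
  under eq_bigr do rewrite convE; rewrite exchange_big /=.
  apply: eq_bigr => h _; rewrite mulr_suml (reindex_inj (conjg_inj h)) /=.
  apply: eq_big => x; last by rewrite conjgE !mulgA mulgK.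
  by rewrite memJ_norm // (subsetP (normal_norm nH)) ?inE.
rewrite mulr_sumr -sumrB; apply: eq_bigr => h _.
by rewrite ffunE mulrBl mulrA.
Qed.

(** By Pythagoras: the Dirac mass has norm 1, and its coset average is uniform on H, of squared norm
    1/|H|. *)
Lemma l2norm_oscillation_dirac :
  l2norm (oscillation H (dirac 1%g) : {ffun G -> R}) ^+ 2 = 1 - #|H|%:R^-1.
Proof.
have oscE g : oscillation H (dirac 1%g) g
    = (g == 1%g)%:R - #|H|%:R^-1 * (g \in H)%:R :> R.
  rewrite !ffunE; congr (_ - _ * _).
  under eq_bigr do rewrite ffunE -{1}(invgK g) -eq_mulVg1.
  have [gH|gH] := boolP (g \in H).
    rewrite (bigD1 g^-1%g) ?groupV //= eqxx big1 ?addr0 // => x /andP[_].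
    by rewrite eq_sym => /negbTE->.
  by rewrite big1 // => x xH; case: eqP xH gH => // <-; rewrite groupV => ->.
rewrite l2norm_sqr (eq_bigr _ (fun g _ => congr1 (fun x => x ^+ 2) (oscE g))).
(* Both indicators are idempotent and their product is the indicator of 1, since 1 lies in H. *)
rewrite (eq_bigr (fun g : G => (g == 1%g)%:R * (1 - #|H|%:R^-1 *+ 2)
   + (g \in H)%:R * #|H|%:R^-1 ^+ 2)); last first.
  move=> g _; case: eqP => [->|_]; first by rewrite group1 /=; ring.
  by case: (g \in H) => /=; ring.
rewrite big_split /= -!mulr_suml -!natr_sum.
rewrite (bigD1 1%g) //= eqxx big1 ?addr0 => [|g /negbTE->//].
have -> : (\sum_g (g \in H))%N = #|H|.
  by rewrite -sum1_card [RHS]big_mkcond.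
by rewrite addn0 /=; field.
Qed.

Lemma oscillation_conv_le f mu : (H <| [set: G])%g -> is_prob mu ->
  l2norm (oscillation H (conv f mu)) ^+ 2 <= l2norm (oscillation H f) ^+ 2.
Proof. by move=> nH mup; rewrite oscillation_conv // l2norm_conv_le. Qed.

Lemma oscillation_conv_subgroup f mu :
    (H <| [set: G])%g -> is_prob mu -> supp mu \subset H ->
  l2norm (oscillation H (conv f mu)) ^+ 2
    <= second_singular_value (conv_op (restrict H mu)) ^+ 2
       * l2norm (oscillation H f) ^+ 2.
Proof.
move=> nH mup muH; rewrite oscillation_conv // l2norm_conv_subgroup // => g.
exact: sum_coset_oscillation.
Qed.

(** A Dirac mass is put in front of the product and generalised to an arbitrary [f], so that
    induction can absorb the factors into [f] from the left. A factor in [I] contributes its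
    singular value, any other factor only contracts. *)
Lemma oscillation_conv_prod n (mu : 'I_n -> {ffun G -> R}) (I : {set 'I_n}) :
    (H <| [set: G])%g -> (forall i, is_prob (mu i)) ->
    (forall i, i \in I -> supp (mu i) \subset H) ->
  l2norm (oscillation H (conv_prod mu)) ^+ 2
    <= (1 - #|H|%:R^-1)
       * \prod_(i in I) second_singular_value (conv_op (restrict H (mu i))) ^+ 2.
Proof.
move=> nH mup muH; rewrite -l2norm_oscillation_dirac -{1}(conv_dirac1l (conv_prod mu)).
move: (dirac 1%g) => f; rewrite /conv_prod.
elim: (index_enum _) f => [|i r IHr] f; first by rewrite !big_nil conv_dirac1r mulr1.
rewrite !big_cons convA; apply: le_trans (IHr _) _.
have prod0 : 0 <= \prod_(j <- r | j \in I)
    second_singular_value (conv_op (restrict H (mu j))) ^+ 2.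
  by apply: prodr_ge0 => j _; apply: sqr_ge0.
case: ifP => iI; last by rewrite ler_wpM2r ?oscillation_conv_le.
by rewrite mulrA ler_wpM2r // [X in _ <= X]mulrC oscillation_conv_subgroup ?muH.
Qed.

End Oscillation.

(** * Pushforward of measures and quotient maps *)

Section Pushforward.
Variable R : realType.

(** Change of variables. Total mass, functoriality and compatibility with convolution all follow
    from suitable choices of [F]. *)
Lemma sum_pushforward (S T : finType) (f : S -> T) (mu : {ffun S -> R}) (F : T -> R) :
  \sum_t F t * pushforward f mu t = \sum_s F (f s) * mu s.
Proof.
rewrite [RHS](partition_big f xpredT) //=; apply: eq_bigr => t _.
by rewrite ffunE mulr_sumr; apply: eq_bigr => s /eqP->.
Qed.

Lemma pushforward_prob (S T : finType) (f : S -> T) (mu : {ffun S -> R}) :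
  is_prob mu -> is_prob (pushforward f mu).
Proof.
move=> [mu0 mu1]; split=> [t|]; first by rewrite ffunE sumr_ge0.
have := sum_pushforward f mu (fun=> 1).
by under eq_bigr do rewrite mul1r; under [in RHS]eq_bigr do rewrite mul1r; rewrite mu1.
Qed.

Lemma pushforwardE (S T : finType) (f : S -> T) (mu : {ffun S -> R}) t :
  pushforward f mu t = \sum_s (f s == t)%:R * mu s.
Proof.
by rewrite ffunE big_mkcond; apply: eq_bigr => s _; case: eqP; rewrite ?mul1r ?mul0r.
Qed.

Lemma pushforward_comp (S T U : finType) (g : T -> U) (f : S -> T) (mu : {ffun S -> R}) :
  pushforward (g \o f) mu = pushforward g (pushforward f mu).
Proof.
apply/ffunP => u; rewrite !pushforwardE.
by rewrite (sum_pushforward f mu (fun t => (g t == u)%:R)).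
Qed.

Lemma pushforward_conv (G G' : finGroupType) (f : G -> G') (mu nu : {ffun G -> R}) :
  {morph f : x y / (x * y)%g} ->
  pushforward f (conv mu nu) = conv (pushforward f mu) (pushforward f nu).
Proof.
move=> fM; apply/ffunP => t.
rewrite pushforwardE [RHS]ffunE; under [RHS]eq_bigr do rewrite mulrC.
rewrite (sum_pushforward f mu (fun s => pushforward f nu (s^-1 * t)%g)).
under eq_bigr do rewrite ffunE mulr_sumr; rewrite exchange_big /=.
apply: eq_bigr => h _; rewrite pushforwardE mulr_suml.
rewrite [LHS](reindex_inj (mulgI h)) /=; apply: eq_bigr => x _.
by rewrite mulKg fM (can2_eq (mulKg (f h)) (mulKVg (f h))) -mulrA [nu x * _]mulrC.
Qed.

Lemma pushforward_dirac (S T : finType) (f : S -> T) s :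
  pushforward f (dirac s) = dirac (f s) :> {ffun T -> R}.
Proof.
apply/ffunP => t; rewrite pushforwardE (bigD1 s) //= !ffunE eqxx mulr1 eq_sym.
by rewrite big1 ?addr0 // => x xs; rewrite ffunE (negbTE xs) mulr0.
Qed.

Lemma pushforward_conv_prod (G G' : finGroupType) (f : G -> G') n
    (mu : 'I_n -> {ffun G -> R}) :
  {morph f : x y / (x * y)%g} ->
  pushforward f (conv_prod mu) = conv_prod (fun i => pushforward f (mu i)).
Proof.
move=> fM; apply: (big_morph (pushforward f)) => [x y|]; first exact: pushforward_conv.
rewrite pushforward_dirac; congr dirac.
by apply: (mulgI (f 1%g)); rewrite -fM !mulg1.
Qed.

Section Surjection.
Variables (G G' : finGroupType) (Q : {morphism [set: G] >-> G'}).
Hypothesis Q_surj : (Q @* [set: G])%g = [set: G'].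

Lemma card_ker_surj : #|G| = (#|('ker Q)%g| * #|G'|)%N.
Proof.
rewrite -cardsT -(Lagrange (subsetT ('ker Q)%g)).
by rewrite -[#|G'|]cardsT -Q_surj card_morphim setTI.
Qed.

(** Every fibre of [Q] is a coset of the kernel, hence has the same size. *)
Lemma sum_surj (F : G' -> R) : \sum_g F (Q g) = #|('ker Q)%g|%:R * \sum_t F t.
Proof.
rewrite (partition_big Q xpredT) //= mulr_sumr; apply: eq_bigr => t _.
have /morphimP[g0 _ _ ->] : t \in (Q @* [set: G])%g by rewrite Q_surj inE.
rewrite (eq_bigr (fun=> F (Q g0))) => [|g /eqP->//].
rewrite sumr_const -[LHS]mulr_natl -(card_rcoset _ g0); congr (_%:R * _).
apply: eq_card => g; rewrite unfold_in /=.
by apply/eqP/rcoset_kerP; rewrite ?inE.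
Qed.

Lemma sum_lcoset_ker (mu : {ffun G -> R}) g :
  \sum_(x in ('ker Q)%g) mu (g * x)%g = pushforward Q mu (Q g).
Proof.
rewrite ffunE [RHS](reindex_inj (mulgI g)) /=; apply: eq_bigl => x.
rewrite morphM ?inE // (can2_eq (mulKg (Q g)) (mulKVg (Q g))) mulVg.
by rewrite (sameP eqP (kerP Q (in_setT x))).
Qed.

(** Pythagoras again: the coset average of [mu] at [g] is the pushforward at [Q g] divided by |ker
    Q|, and each value is repeated |ker Q| times. This identity makes the norms along the tower
    telescope. *)
Lemma l2norm_oscillation_ker (mu : {ffun G -> R}) :
  l2norm (oscillation ('ker Q)%G mu) ^+ 2
  = l2norm mu ^+ 2 - l2norm (pushforward Q mu) ^+ 2 / #|('ker Q)%g|%:R.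
Proof.
have K0 : #|('ker Q)%g|%:R != 0 :> R by rewrite pnatr_eq0 -lt0n cardG_gt0.
set a := #|('ker Q)%g|%:R in K0 *; set nu := pushforward Q mu.
rewrite !l2norm_sqr.
under eq_bigr do rewrite ffunE (sum_lcoset_ker mu) -/a -/nu.
rewrite (eq_bigr (fun g => mu g ^+ 2 - (a^-1 *+ 2) * (nu (Q g) * mu g)
    + a^-1 ^+ 2 * nu (Q g) ^+ 2)); last by move=> g _; ring.
rewrite big_split sumrB /= -!mulr_sumr (sum_surj (fun t => nu t ^+ 2)).
rewrite -(sum_pushforward Q mu nu) -/nu.
under [X in _ - _ * X]eq_bigr do rewrite -expr2.
by rewrite -/a; field.
Qed.

End Surjection.
End Pushforward.

(** * Total mass, orders in the tower, and the telescoping sum *)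

Lemma sum_conv_prod (R : realType) (G : finGroupType) n (mu : 'I_n -> {ffun G -> R}) :
  (forall i, \sum_g mu i g = 1) -> \sum_g conv_prod mu g = 1.
Proof.
move=> mu1; rewrite /conv_prod.
apply: (big_ind (fun f : {ffun G -> R} => \sum_g f g = 1)) => // [|f nu f1 nu1].
  rewrite (bigD1 1%g) //= ffunE eqxx big1 ?addr0 // => g g1.
  by rewrite ffunE (negbTE g1).
under eq_bigr do rewrite ffunE.
rewrite exchange_big /= -[RHS]f1; apply: eq_bigr => h _.
by rewrite -mulr_sumr sum_mulg nu1 mulr1.
Qed.

Lemma l2norm_sub_uniform (R : realType) (S : finType) (f : {ffun S -> R}) :
  (0 < #|S|)%N -> \sum_s f s = 1 ->
  l2norm (f - uniform S) ^+ 2 = l2norm f ^+ 2 - #|S|%:R^-1.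
Proof.
move=> S0 f1; have S1 : #|S|%:R != 0 :> R by rewrite pnatr_eq0 -lt0n.
rewrite !l2norm_sqr; set a := #|S|%:R^-1.
rewrite (eq_bigr (fun s => f s ^+ 2 - a *+ 2 * f s + a ^+ 2)); last first.
  by move=> s _; rewrite !ffunE -/a; ring.
rewrite big_split sumrB /= -mulr_sumr f1 sumr_const -mulr_natl /a.
by field.
Qed.

Lemma l2norm_singleton (R : realType) (S : finType) (f : {ffun S -> R}) :
  #|S| = 1%N -> \sum_s f s = 1 -> l2norm f ^+ 2 = 1.
Proof.
move=> S1; have /fintype1P [x xE] : #|S| == 1%N by rewrite S1.
by rewrite l2norm_sqr !(big_pred1 x) => [->|s|s]; rewrite ?expr1n // (xE s) /= eqxx.
Qed.

Section Tower.
Variables (R : realType) (G : nat -> finGroupType).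
Variable Q : forall j, {morphism [set: G j] >-> G j.+1}.

Lemma QtildeM j : {morph @Qtilde G Q j : x y / (x * y)%g}.
Proof. by elim: j => [|j IHj] x y //=; rewrite IHj morphM ?inE. Qed.

Lemma card_tower k j : (j <= k)%N ->
    (forall i, (i < k)%N -> (Q i @* [set: G i])%g = [set: G i.+1]) ->
    #|G k| = 1%N ->
  #|G j| = (\prod_(j <= l < k) #|Hker Q l|)%N.
Proof.
(* Downward induction on [j], written as [k - m] with [m] growing from 0. *)
move=> jk Q_surj Gk; rewrite -(subKn jk); elim: (k - j)%N (leq_subr j k) => [|m IHm] mk.
  by rewrite subn0 big_geq.
have mk1 : (k - m.+1 < k)%N by lia.
rewrite big_ltn // (card_ker_surj (Q_surj _ mk1)); congr (_ * _)%N.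
by rewrite -(subnSK mk) in IHm *; apply: IHm; apply: ltnW.
Qed.

End Tower.

Theorem theorem2p1 (R : realType) (k : nat) (G : nat -> finGroupType)
    (Q : forall j, {morphism [set: G j] >-> G j.+1})
    (Q_surj : forall j, (j < k)%N -> (Q j @* [set: G j])%g = [set: G j.+1])
    (Gk_trivial : [set: G k] = 1%g)
    (n : nat) (mu : 'I_n -> {ffun G 0%N -> R})
    (mu_prob : forall i, is_prob (mu i))
    (I_nonempty : forall j, (j < k)%N -> Iset Q mu j != set0) :
  l2norm (conv_prod mu - uniform (G 0%N)) ^+ 2
    <= \sum_(j < k) (#|G j|%:R - 1) / #|G 0%N|%:R
         * \prod_(i in Iset Q mu j) sigma Q mu j i ^+ 2
  /\ \sum_(j < k) (#|G j|%:R - 1) / #|G 0%N|%:R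
       * \prod_(i in Iset Q mu j) sigma Q mu j i ^+ 2
     = \sum_(j < k) ((\prod_(j <= l < k) #|Hker Q l|)%N%:R - 1) / #|G 0%N|%:R
         * \prod_(i in Iset Q mu j) sigma Q mu j i ^+ 2 :> R.
Proof.
have Gk : #|G k| = 1%N by rewrite -cardsT Gk_trivial cards1.
split; last first.
  by apply: eq_bigr => j _; rewrite -(card_tower (ltnW (ltn_ord j)) Q_surj Gk).
have G_gt0 j : (0 < #|G j|)%N by rewrite -cardsT cardG_gt0.
have GR_gt0 j : 0 < #|G j|%:R :> R by rewrite ltr0n.
pose nu j := pushforward (@Qtilde G Q j) (conv_prod mu).
have nu0 : nu 0%N = conv_prod mu.
  by apply/ffunP => g; rewrite ffunE big_pred1_eq.
have nuS j : nu j.+1 = pushforward (Q j) (nu j).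
  by rewrite -pushforward_comp.
have nuE j : nu j = conv_prod (walk_measure Q mu j).
  by rewrite /nu pushforward_conv_prod //; apply: QtildeM.
have walk_prob j i : is_prob (walk_measure Q mu j i) by apply: pushforward_prob.
have nu1 j : \sum_g nu j g = 1.
  by rewrite nuE sum_conv_prod // => i; case: (walk_prob j i).
(* For [j <= k], this is the squared norm in L^2(G 0) of the average of nu_n over the fibres of
   [Qtilde j], each of size |G 0|/|G j|. At [k] it equals 1/|G 0|, the squared norm of the uniform
   distribution. *)
pose a j : R := #|G j|%:R / #|G 0%N|%:R * l2norm (nu j) ^+ 2.
have -> : l2norm (conv_prod mu - uniform (G 0%N)) ^+ 2 = a 0%N - a k.
  rewrite -nu0 l2norm_sub_uniform ?nu1 // /a (l2norm_singleton Gk (nu1 k)) Gk.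
  by rewrite mulr1 mul1r divff ?mul1r // gt_eqF.
rewrite -[_ - _]opprB -(telescope_sumr a (leq0n k)) -sumrN big_mkord.
apply: ler_sum => j _; rewrite opprB.
have surj := Q_surj _ (ltn_ord j).
have cardj : #|G j|%:R = #|Hker Q j|%:R * #|G j.+1|%:R :> R.
  by rewrite -natrM (card_ker_surj surj).
have H_gt0 : 0 < #|Hker Q j|%:R :> R by rewrite ltr0n cardG_gt0.
have -> : a j - a j.+1
    = #|G j|%:R / #|G 0%N|%:R * l2norm (oscillation (Hker Q j) (nu j)) ^+ 2.
  rewrite (l2norm_oscillation_ker surj) -nuS /a cardj; field.
  by rewrite !gt_eqF.
have nH : (Hker Q j <| [set: G j])%g by apply: ker_normal.
have suppH i : i \in Iset Q mu j -> supp (walk_measure Q mu j i) \subset Hker Q j.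
  by rewrite inE => /eqP <-; apply: subset_gen.
have := oscillation_conv_prod nH (walk_prob j) suppH.
rewrite -nuE => osc_le.
apply: le_trans (ler_wpM2l _ osc_le) _; first by rewrite divr_ge0 ?ler0n.
rewrite mulrA ler_wpM2r ?prodr_ge0 // => [i _|]; first exact: sqr_ge0.
(* Passing from |G j| (1 - 1/|H_j|) to |G j| - 1 amounts to |G j|/|H_j| = |G j.+1| being at least
   1. *)
rewrite mulrAC ler_wpM2r ?invr_ge0 ?ler0n // mulrBr mulr1 lerD2l lerN2.
by rewrite cardj mulrAC mulfV ?gt_eqF // mul1r ler1n.
Qed.
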